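(* Every semi-Heyting algebra satisfying $x\to y\approx y\to x$ satisfies $(x^*\to x)^*\approx1$. Hence $\mathbb{SH}_c\subseteq\mathbb{AT}1$.
   Context: A semi-Heyting algebra is an algebra $\langle A;\wedge,\vee,\to,0,1\rangle$ such that $\langle A;\wedge,\vee,0,1\rangle$ is a bounded lattice and the identities $x\wedge(x\to y)\approx x\wedge y$, $x\wedge(y\to z)\approx x\wedge((x\wedge y)\to(x\wedge z))$, $x\to x\approx1$ hold. Write $x^*:=x\to0$. $\mathbb{SH}_c$ is the variety of semi-Heyting algebras satisfying $x\to y\approx y\to x$, and $\mathbb{AT}1$ is the variety of semi-Heyting algebras satisfying $(x^*\to x)^*\approx1$. *)

(* Defs.v *)
From mathcomp Require Import ssreflect ssrfun.

Set Implicit Arguments.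
Unset Strict Implicit.
Unset Printing Implicit Defensive.

Declare Scope sh_scope.
Delimit Scope sh_scope with SH.

(* Algebras of type (2,2,2,0,0).  The carrier is an arbitrary type, and bounded
   lattices are axiomatized by identities, rather than taken as tbLatticeType,
   which would also require decidable equality, a decidable order and a choice
   operator on the carrier. *)
Record algebra := Algebra {
  carrier :> Type;
  meet : carrier -> carrier -> carrier;
  join : carrier -> carrier -> carrier;
  imp : carrier -> carrier -> carrier;
  bot : carrier;
  top : carrier
}.

Arguments bot {a}.
Arguments top {a}.

Notation "x ∧ y" := (meet x y) (at level 40, left associativity) : sh_scope.
Notation "x ∨ y" := (join x y) (at level 50, left associativity) : sh_scope.
Notation "x → y" := (imp x y) (at level 60, right associativity) : sh_scope.
Notation "𝟎" := bot : sh_scope.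
Notation "𝟏" := top : sh_scope.

Open Scope sh_scope.

Definition pcompl (A : algebra) (x : A) : A := x → 𝟎.

Notation "x ^*" := (pcompl x) : sh_scope.

Record bounded_lattice (A : algebra) : Prop := BoundedLattice {
  meetA : associative (@meet A);
  meetC : commutative (@meet A);
  joinA : associative (@join A);
  joinC : commutative (@join A);
  meetKU : forall x y : A, x ∧ (x ∨ y) = x;
  joinKI : forall x y : A, x ∨ (x ∧ y) = x;
  join0x : left_id 𝟎 (@join A);
  meet1x : left_id 𝟏 (@meet A)
}.

Record semi_Heyting (A : algebra) : Prop := SemiHeyting {
  sh_bounded_lattice : bounded_lattice A;
  sh_meet_imp : forall x y : A, x ∧ (x → y) = x ∧ y;
  sh_meet_impI : forall x y z : A, x ∧ (y → z) = x ∧ ((x ∧ y) → (x ∧ z));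
  sh_impxx : forall x : A, x → x = 𝟏
}.

Definition SHc (A : algebra) : Prop :=
  semi_Heyting A /\ forall x y : A, x → y = y → x.

Definition AT1 (A : algebra) : Prop :=
  semi_Heyting A /\ forall x : A, (x^* → x)^* = 𝟏.

Definition subclass (V W : algebra -> Prop) : Prop := forall A, V A -> W A.

(* Main.v *)
Require Import Defs.
From mathcomp Require Import ssreflect ssrfun.

Set Implicit Arguments.
Unset Strict Implicit.
Unset Printing Implicit Defensive.

(** In a semi-Heyting algebra [x^*] is the pseudocomplement of [x] ([meet_pcompl],
    [meet_pcompl_disjoint]). Commutativity of [→] then forces [x^* → x = 𝟎], and [𝟎^*] is
    [𝟎 → 𝟎 = 𝟏]. *)

Lemma meet0x (A : algebra) : bounded_lattice A -> left_zero 𝟎 (@meet A).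
Proof. by move=> L x; rewrite -(join0x L (𝟎 ∧ x)) (joinKI L). Qed.

Lemma meet_pcompl (A : algebra) : semi_Heyting A ->
  forall x : A, x ∧ x^* = 𝟎.
Proof.
move=> H x; have L := sh_bounded_lattice H.
by rewrite /pcompl (sh_meet_imp H) (meetC L) (meet0x L).
Qed.

(** Under a meet with [y], both arguments of [x → 𝟎] may be met with [y], which turns it into
    [𝟎 → 𝟎 = 𝟏]. *)
Lemma meet_pcompl_disjoint (A : algebra) : semi_Heyting A ->
  forall x y : A, y ∧ x = 𝟎 -> y ∧ x^* = y.
Proof.
move=> H x y yx0; have L := sh_bounded_lattice H.
rewrite /pcompl (sh_meet_impI H) yx0 (meetC L y 𝟎) (meet0x L) (sh_impxx H).
by rewrite (meetC L) (meet1x L).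
Qed.

(* By commutativity of the implication, [x^* → x] is disjoint from both [x]
   and [x^*]; disjointness from [x] puts it below [x^*], so it is [𝟎]. *)
Lemma imp_pcompl_eq0 (A : algebra) : semi_Heyting A ->
  (forall x y : A, x → y = y → x) -> forall x : A, x^* → x = 𝟎.
Proof.
move=> H impC x; have L := sh_bounded_lattice H.
have wx : (x^* → x) ∧ x = 𝟎.
  by rewrite impC (meetC L) (sh_meet_imp H) (meet_pcompl H).
rewrite -(meet_pcompl_disjoint H wx) (meetC L) (sh_meet_imp H).
by rewrite (meetC L) (meet_pcompl H).
Qed.

Theorem theorem7p9 :
  (forall A : algebra, semi_Heyting A ->
     (forall x y : A, x → y = y → x) ->
     forall x : A, (x^* → x)^* = 𝟏) /\
  subclass SHc AT1.
Proof.
have main (A : algebra) : semi_Heyting A ->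
    (forall x y : A, x → y = y → x) -> forall x : A, (x^* → x)^* = 𝟏.
  by move=> H impC x; rewrite (imp_pcompl_eq0 H impC) /pcompl (sh_impxx H).
by split=> // A [H impC]; split=> //; apply: main.
Qed.
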